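(* Let $d\ge 2$, let $P$ be a plus-antipodal $d$-SMP of cardinality $2^d-2$, and let $a_n$ denote the number of $d$-dimensional permutations of length $n$ avoiding $P$. Then, as formal power series, $$A(x):=\sum_{n\ge 0}a_nx^n=\frac{F_d(x)}{1+xF_d(x)}$$ and $$F_P(x,q)=\frac{F_d(x)}{1+x(1-q)F_d(x)}.$$
   Context: A $d$-dimensional permutation $\Pi$ of length $n$ is an ordered $(d-1)$-tuple $(\pi^2,\dots,\pi^d)$ of permutations of $\{1,\dots,n\}$, with $\pi^i=\pi^i_1\cdots\pi^i_n$; set $\pi^1=12\cdots n$. Its elements are the $d$-tuples $\Pi_j=(\pi^1_j,\pi^2_j,\dots,\pi^d_j)^T$, $1\le j\le n$. $S^d_n$ is the set of $d$-dimensional permutations of length $n$; for $n=0$ there is exactly one (empty) permutation, which has no occurrences of any pattern, so $a_0=1$. A $d$-dimensional singleton mesh pattern ($d$-SMP) $P$ is a set of $d$-tuples in $\{+,-\}^d$; its cardinality is $|P|$. For $i\ne j$, $\mathrm{sign}(\Pi_j-\Pi_i)\in\{+,-\}^d$ denotes the tuple of componentwise signs. The element $\Pi_i$ is an occurrence of $P$ in $\Pi$ if there is no $j\neq i$ with $\mathrm{sign}(\Pi_j-\Pi_i)\in P$. $\Pi$ avoids $P$ if it has no occurrences of $P$. For $C\in\{+,-\}^d$, $c(C)$ is obtained by replacing each $+$ by $-$ and each $-$ by $+$. $P$ is plus-antipodal if for every $C\in\{+,-\}^d$: $C\in P$ if and only if $c(C)\in P$. $F_P(x,q)=\sum_{n\ge0}x^n\sum_{\sigma\in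 S^d_n}q^{\#\text{occurrences of }P\text{ in }\sigma}$ and $F_d(x)=\sum_{n\ge0}(n!)^{d-1}x^n$. *)

(* Defs.v *)
From HB Require Import structures.
From mathcomp Require Import all_boot all_order all_fingroup all_algebra.
From mathcomp Require Import boolp.

Set Implicit Arguments.
Unset Strict Implicit.
Unset Printing Implicit Defensive.

Import GRing.Theory.
Local Open Scope ring_scope.

(* Formal power series R[[x]]; fpsX is the variable, fpsC the embedding of R.  *)
(* Their eqType and choiceType structures are the classical ones.             *)
Record fps (R : Type) := Fps { fcoef : nat -> R }.

HB.instance Definition _ (R : Type) := gen_eqMixin (fps R).
HB.instance Definition _ (R : Type) := gen_choiceMixin (fps R).

Lemma fpsP (R : Type) (f g : fps R) : fcoef f =1 fcoef g -> f = g.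
Proof. by case: f g => [f] [g] /= /funext ->. Qed.

Section FpsRing.
Variable R : comUnitRingType.
Implicit Types f g h : fps R.

Definition fps0 : fps R := Fps (fun=> 0).
Definition fps_opp f : fps R := Fps (fun n => - fcoef f n).
Definition fps_add f g : fps R := Fps (fun n => fcoef f n + fcoef g n).
Definition fpsC (c : R) : fps R := Fps (fun n => if n == 0%N then c else 0).
Definition fps_mul f g : fps R :=
  Fps (fun n => \sum_(i < n.+1) fcoef f i * fcoef g (n - i)%N).

Lemma fps_addA : associative fps_add.
Proof. by move=> f g h; apply: fpsP => n /=; rewrite addrA. Qed.
Lemma fps_addC : commutative fps_add.
Proof. by move=> f g; apply: fpsP => n /=; rewrite addrC. Qed.
Lemma fps_add0 : left_id fps0 fps_add.
Proof. by move=> f; apply: fpsP => n /=; rewrite add0r. Qed.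
Lemma fps_addN : left_inverse fps0 fps_opp fps_add.
Proof. by move=> f; apply: fpsP => n /=; rewrite addNr. Qed.

HB.instance Definition _ :=
  GRing.isZmodule.Build (fps R) fps_addA fps_addC fps_add0 fps_addN.

Lemma fps_mulC : commutative fps_mul.
Proof.
move=> f g; apply: fpsP => n /=; rewrite (reindex_inj rev_ord_inj) /=.
by apply: eq_bigr => i _; rewrite subSS mulrC subKn // -ltnS.
Qed.

Lemma fps_mulA : associative fps_mul.
Proof.
(* reduction to the truncations, which are polynomials *)
have mulE f g n m : (n < m)%N ->
  fcoef (fps_mul f g) n =
  ((\poly_(i < m) fcoef f i) * (\poly_(i < m) fcoef g i))`_n.
  move=> nm; rewrite coefM /=; apply: eq_bigr => i _.
  have im : (i < m)%N by apply: leq_ltn_trans nm; rewrite -ltnS.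
  have nim : (n - i < m)%N by apply: leq_ltn_trans nm; rewrite leq_subr.
  by rewrite !coef_poly im nim.
move=> f g h; apply: fpsP => n /=.
transitivity (((\poly_(i < n.+1) fcoef f i) *
   ((\poly_(i < n.+1) fcoef g i) * (\poly_(i < n.+1) fcoef h i)))`_n).
  rewrite coefM; apply: eq_bigr => i _.
  rewrite -(mulE g h) ?ltnS ?leq_subr //.
  by rewrite coef_poly ltn_ord.
rewrite mulrA coefM; apply: eq_bigr => i _.
by rewrite -mulE // coef_poly ltnS leq_subr.
Qed.

Lemma fps_mul1 : left_id (fpsC 1) fps_mul.
Proof.
move=> f; apply: fpsP => n /=; rewrite big_ord_recl /= mul1r subn0.
by rewrite big1 ?addr0 // => i _; rewrite mul0r.
Qed.

Lemma fps_mulD : left_distributive fps_mul fps_add.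
Proof.
move=> f g h; apply: fpsP => n /=; rewrite -big_split /=.
by apply: eq_bigr => i _; rewrite mulrDl.
Qed.

Lemma fps_1neq0 : fpsC 1 != 0.
Proof.
by apply/eqP => /(congr1 (fun f => fcoef f 0)) /= /eqP; rewrite oner_eq0.
Qed.

HB.instance Definition _ := GRing.Zmodule_isComNzRing.Build (fps R)
  fps_mulA fps_mulC fps_mul1 fps_mulD fps_1neq0.

Lemma fcoefD f g n : fcoef (f + g) n = fcoef f n + fcoef g n.
Proof. by []. Qed.
Lemma fcoefN f n : fcoef (- f) n = - fcoef f n.
Proof. by []. Qed.
Lemma fcoef1 n : fcoef (1 : fps R) n = (n == 0%N)%:R.
Proof. by rewrite /=; case: eqP. Qed.
Lemma fcoefM f g n :
  fcoef (f * g) n = \sum_(i < n.+1) fcoef f i * fcoef g (n - i)%N.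
Proof. by []. Qed.
Lemma fcoef_sum I (r : seq I) (P : pred I) (F : I -> fps R) n :
  fcoef (\sum_(i <- r | P i) F i) n = \sum_(i <- r | P i) fcoef (F i) n.
Proof. by apply: (big_morph (fun f => fcoef f n)). Qed.
Lemma fcoefCM c f n : fcoef (fpsC c * f) n = c * fcoef f n.
Proof.
rewrite fcoefM big_ord_recl /= subn0.
by rewrite big1 ?addr0 // => i _; rewrite mul0r.
Qed.

Lemma fcoef_exp_small f k n :
  fcoef f 0 = 0 -> (n < k)%N -> fcoef (f ^+ k) n = 0.
Proof.
move=> f0; elim: k n => // k IHk n nk; rewrite exprS fcoefM big_ord_recl.
rewrite f0 mul0r add0r big1 // => i _; rewrite IHk ?mulr0 //=.
by rewrite /bump /= add1n; case: n nk i => [|n] nk [i] //= _;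
   rewrite subSS (leq_ltn_trans (leq_subr _ _)).
Qed.

(* With a := f_0 a unit and u := 1 - a^-1 f, the inverse of f is given by the *)
(* geometric series a^-1 (1 + u + u^2 + ...), in which only the u^k with      *)
(* k <= n contribute to the coefficient of x^n.                               *)
Definition fps_unit : {pred fps R} := [pred f | fcoef f 0 \is a GRing.unit].
Definition fps_inv f : fps R :=
  if f \in fps_unit then
    let a := fcoef f 0 in let u := 1 - fpsC a^-1 * f in
    Fps (fun n => a^-1 * \sum_(k < n.+1) fcoef (u ^+ k) n)
  else f.

Lemma fps_mulV : {in fps_unit, left_inverse 1 fps_inv *%R}.
Proof.
move=> f uf; rewrite mulrC /fps_inv uf; rewrite inE in uf.
set a := fcoef f 0 in uf *; set u := 1 - _.
have u0 : fcoef u 0 = 0 by rewrite /u fcoefD fcoefN fcoefCM mulVr //= subrr.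
apply: fpsP => n; rewrite fcoefM.
transitivity (fcoef ((1 - u) * \sum_(k < n.+1) u ^+ k) n); last first.
  have -> : (1 - u) * \sum_(k < n.+1) u ^+ k = 1 - u ^+ n.+1.
    by rewrite -[in RHS](expr1n _ n.+1) subrXX; congr (_ * _);
       apply: eq_bigr => i _; rewrite expr1n mul1r.
  by rewrite fcoefD fcoefN (fcoef_exp_small u0) // subr0.
rewrite fcoefM; apply: eq_bigr => i _.
have -> : 1 - u = fpsC a^-1 * f by rewrite /u subKr.
rewrite fcoefCM [fcoef (Fps _) _]/= mulrA [_ * a^-1]mulrC; congr (_ * _).
rewrite fcoef_sum -!(big_mkord xpredT (fun k => fcoef (u ^+ k) (n - i))).
rewrite [RHS](@big_cat_nat _ _ _ (n - i).+1) ?ltnS ?leq_subr //=.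
rewrite [X in _ = _ + X]big_nat_cond [X in _ = _ + X]big1 ?addr0 // => k.
by rewrite andbT => /andP[/(fcoef_exp_small u0)].
Qed.

Lemma fps_unitP f g : g * f = 1 -> f \in fps_unit.
Proof.
move=> /(congr1 (fun h => fcoef h 0)); rewrite fcoefM big_ord1 /= => gf.
by rewrite inE; apply/unitrPr; exists (fcoef g 0); rewrite mulrC.
Qed.

Lemma fps_inv_out : {in [predC fps_unit], fps_inv =1 id}.
Proof. by move=> f; rewrite inE /= /fps_inv => /negbTE ->. Qed.

HB.instance Definition _ := GRing.ComNzRing_hasMulInverse.Build (fps R)
  fps_mulV fps_unitP fps_inv_out.

Definition fpsX : fps R := Fps (fun n => (n == 1%N)%:R).

End FpsRing.

Arguments fpsX {R}.

(* Permutations are of 'I_n = {0, ..., n-1} instead of {1, ..., n}. *)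
Definition dperm (d n : nat) := (d.-1).-tuple 'S_n.

(* The j-th element (pi^1_j, ..., pi^d_j), where pi^1 is the identity. *)
Definition elt (d n : nat) (Pi : dperm d n) (j : 'I_n) : d.-tuple 'I_n :=
  [tuple (nth 1%g (1%g :: Pi) k : 'S_n) j | k < d].

(* true stands for + and false for -. *)
Definition signs (d : nat) := d.-tuple bool.

(* sign (Pi_j - Pi_i); only meant for i != j, so that no component vanishes. *)
Definition sgn (d n : nat) (Pi : dperm d n) (i j : 'I_n) : signs d :=
  [tuple (tnth (elt Pi i) k < tnth (elt Pi j) k)%N | k < d].

(* d-dimensional singleton mesh patterns *)
Definition smp (d : nat) := {set signs d}.

Definition csigns (d : nat) (C : signs d) : signs d :=
  [tuple ~~ tnth C k | k < d].

Definition plus_antipodal (d : nat) (P : smp d) : Prop :=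
  forall C : signs d, C \in P <-> csigns C \in P.

Definition occ (d n : nat) (P : smp d) (Pi : dperm d n) : {set 'I_n} :=
  [set i | [forall j, (j != i) ==> (sgn Pi i j \notin P)]].

Definition avoids (d n : nat) (P : smp d) (Pi : dperm d n) : bool :=
  occ P Pi == set0.

Definition num_avoiders (d : nat) (P : smp d) (n : nat) : nat :=
  #|[set Pi : dperm d n | avoids P Pi]|.

Definition A_series (d : nat) (P : smp d) : fps int :=
  Fps (fun n => (num_avoiders P n)%:R).

(* Coefficients in Z[q], the polynomial variable 'X playing the role of q. *)
Definition FP_series (d : nat) (P : smp d) : fps {poly int} :=
  Fps (fun n => \sum_(Pi : dperm d n) 'X ^+ #|occ P Pi|).

(* The coefficient ring R is a parameter, to view F_d(x) in both Z[[x]] and   *)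
(* Z[q][[x]].                                                                 *)
Definition Fd_series (R : comUnitRingType) (d : nat) : fps R :=
  Fps (fun n => (n`! ^ d.-1)%:R).

(* Main.v *)
Require Import Defs.
From mathcomp Require Import all_boot all_order all_fingroup all_algebra.
From mathcomp Require Import zify.
Import GRing.Theory.
Local Open Scope ring_scope.

(** The complement of [P] is a pair of opposite sign vectors [C], [csigns C]
    ([antipodal_compl]), so an element is an occurrence of [P] exactly when
    every other element lies in direction [C] or [csigns C] from it.
    Complementing the values of the components whose sign in [C] differs from
    the first one is a bijection of the [d]-dimensional permutations that turns [C] into a constant vector ([align], [occ_csfix]).
    After this change, an occurrence at position [i] is a strong fixed point at
    [i] common to the [m = d - 1] permutations: whatever is to the left is
    smaller and whatever is to the right is larger.

    A tuple of permutations with a common strong fixed point at [a] is the block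
    sum of a tuple of permutations of length [a], a fixed point, and a tuple of
    permutations of length [b = n - a - 1]; the common strong fixed points to
    the right of [a] are those of the last block ([csfix_gf_split]). Marking
    one element of a finite set, and weighting only what lies to its right,
    gives [q ^ |A| = 1 + (q - 1) \sum_(i in A) q ^ |{j in A | j > i}|]
    ([expr_card_above], a telescoping sum). Hence the coefficients [f_n] of the
    generating function satisfy
    [f_n = n! ^ m + (q - 1) \sum_(i < n) i! ^ m f_(n - i - 1)]
    ([csfix_gf_rec]), that is, [f = F_d + (q - 1) x F_d f], and solving for [f]
    gives the formula ([csfix_series]).

    The weight [q] is an element of an arbitrary ring: the indeterminate ['X]
    yields [F_P], and the integer [0], for which [0 ^ k] is the indicator of
    [k = 0], yields the series of the avoiders. *)

(** * Strong fixed points *)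

(** The equality of the two comparisons also constrains [j < i]: both fail, and
    [s j < s i] as [s] is injective. *)
Definition sfix {n} (s : 'S_n) : {set 'I_n} :=
  [set i | [forall j : 'I_n, (s i < s j)%N == (i < j)%N]].

Definition csfix {m n} (t : m.-tuple 'S_n) : {set 'I_n} :=
  [set i | [forall k, i \in sfix (tnth t k)]].

Lemma sfixP {n} (s : 'S_n) i :
  reflect (forall j : 'I_n, (s i < s j)%N = (i < j)%N) (i \in sfix s).
Proof.
rewrite inE; apply: (iffP forallP) => fix_i j; last by rewrite fix_i.
exact: (eqP (fix_i j)).
Qed.

Lemma csfixP {m n} (t : m.-tuple 'S_n) i :
  reflect (forall k, i \in sfix (tnth t k)) (i \in csfix t).
Proof. by rewrite inE; apply: forallP. Qed.

(** As many values lie below [s i] as positions lie below [i]. *)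
Lemma sfix_fixed {n} {s : 'S_n} {i} : i \in sfix s -> s i = i.
Proof.
move=> /sfixP si; apply/val_inj/eqP => /=.
have card_le (x : 'I_n) : #|[set j : 'I_n | (j < x.+1)%N]| = x.+1.
  rewrite -sum1_card; under eq_bigl do rewrite inE.
  by rewrite (big_ord_narrow (ltn_ord x)) sum1_card card_ord.
suff: #|[set j : 'I_n | (j < (s i).+1)%N]| = #|[set j : 'I_n | (j < i.+1)%N]|.
  by rewrite !card_le => -[->].
rewrite -(card_preimset _ (@perm_inj _ s)); apply: eq_card => j.
by rewrite !inE !ltnS leqNgt si -leqNgt.
Qed.

(** * Block sums *)

(** The sum of [s], a fixed point at [a], and [t]. The last two blocks form
    ['I_b.+1], whose [ord0] is the fixed point. *)
Definition block_fun {a b} (s : 'S_a) (t : 'S_b) (x : 'I_(a + b.+1)) :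
    'I_(a + b.+1) :=
  match split x with
  | inl j => lshift b.+1 (s j)
  | inr k => rshift a (oapp (fun k' => lift ord0 (t k')) ord0 (unlift ord0 k))
  end.

Lemma block_fun_lo {a b} (s : 'S_a) (t : 'S_b) j :
  block_fun s t (lshift b.+1 j) = lshift b.+1 (s j).
Proof. by rewrite /block_fun (unsplitK (inl j)). Qed.

Lemma block_fun_mid {a b} (s : 'S_a) (t : 'S_b) :
  block_fun s t (rshift a ord0) = rshift a ord0.
Proof. by rewrite /block_fun (unsplitK (inr ord0)) unlift_none. Qed.

Lemma block_fun_hi {a b} (s : 'S_a) (t : 'S_b) k :
  block_fun s t (rshift a (lift ord0 k)) = rshift a (lift ord0 (t k)).
Proof. by rewrite /block_fun (unsplitK (inr _)) liftK. Qed.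

Variant block_spec {a b} : 'I_(a + b.+1) -> Type :=
  | BlockLo j : block_spec (lshift b.+1 j)
  | BlockMid : block_spec (rshift a ord0)
  | BlockHi k : block_spec (rshift a (lift ord0 k)).

Lemma blockP {a b} (x : 'I_(a + b.+1)) : block_spec x.
Proof.
rewrite -(splitK x); case: (split x) => [j|k] /=; first exact: BlockLo.
case: (unliftP ord0 k) => [k'|] ->; [exact: BlockHi | exact: BlockMid].
Qed.

Lemma block_funK {a b} (s : 'S_a) (t : 'S_b) :
  cancel (block_fun s t) (block_fun s^-1 t^-1).
Proof.
move=> x; case: (blockP x) => [j||k].
- by rewrite !block_fun_lo permK.
- by rewrite !block_fun_mid.
- by rewrite !block_fun_hi permK.
Qed.

Definition block_perm {a b} (s : 'S_a) (t : 'S_b) : 'S_(a + b.+1) :=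
  perm (can_inj (block_funK s t)).

Lemma block_permE {a b} (s : 'S_a) (t : 'S_b) : block_perm s t =1 block_fun s t.
Proof. exact: permE. Qed.

Lemma block_perm_inj {a b} (s s' : 'S_a) (t t' : 'S_b) :
  block_perm s t = block_perm s' t' -> s = s' /\ t = t'.
Proof.
move=> /permP eq_st; split; apply/permP => x.
  have := eq_st (lshift b.+1 x).
  by rewrite !block_permE !block_fun_lo => /lshift_inj.
have := eq_st (rshift a (lift ord0 x)).
by rewrite !block_permE !block_fun_hi => /rshift_inj/lift_inj.
Qed.

Lemma block_perm_sfix_mid {a b} (s : 'S_a) (t : 'S_b) :
  rshift a ord0 \in sfix (block_perm s t).
Proof.
apply/sfixP => x; rewrite !block_permE block_fun_mid.
case: (blockP x) => [j||k].
- rewrite block_fun_lo /=; have := ltn_ord j; have := ltn_ord (s j); lia.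
- by rewrite block_fun_mid.
- by rewrite block_fun_hi /= /bump; lia.
Qed.

Lemma block_perm_sfix_hi {a b} (s : 'S_a) (t : 'S_b) k :
  (rshift a (lift ord0 k) \in sfix (block_perm s t)) = (k \in sfix t).
Proof.
apply/sfixP/sfixP => fix_k x; last first.
  rewrite !block_permE block_fun_hi; case: (blockP x) => [j||k'].
  - rewrite block_fun_lo /= /bump; have := ltn_ord j; have := ltn_ord (s j); lia.
  - by rewrite block_fun_mid /= /bump; lia.
  - by have := fix_k k'; rewrite block_fun_hi /= /bump; lia.
have := fix_k (rshift a (lift ord0 x)).
by rewrite !block_permE !block_fun_hi /= /bump; lia.
Qed.

(** Around a strong fixed point, positions below [a] go to values below [a], and
    likewise above, so [u] restricts to both sides. *)
Lemma sfix_block_perm {a b} {u : 'S_(a + b.+1)} :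
  rshift a ord0 \in sfix u -> exists s t, u = block_perm s t.
Proof.
move=> u_mid; have fix_mid := sfix_fixed u_mid; move/sfixP: u_mid => u_mid.
rewrite fix_mid in u_mid.
have hi k : (a < u (rshift a (lift ord0 k)))%N.
  by have := u_mid (rshift a (lift ord0 k)); rewrite /= /bump; lia.
have lo j : (u (lshift b.+1 j) < a)%N.
  have := u_mid (lshift b.+1 j); have := ltn_ord j.
  have: u (lshift b.+1 j) != rshift a ord0.
    by rewrite -fix_mid (inj_eq perm_inj) eq_lrshift.
  by rewrite -val_eqE /=; lia.
have hi_sub k : (u (rshift a (lift ord0 k)) - a.+1 < b)%N.
  by have := hi k; have := ltn_ord (u (rshift a (lift ord0 k))); lia.
pose f j := Ordinal (lo j); pose g k := Ordinal (hi_sub k).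
have f_inj : injective f.
  move=> j j' /(congr1 val) /= /val_inj /perm_inj; exact: lshift_inj.
have g_inj : injective g.
  move=> k k' /(congr1 val) /= eq_k; apply: (@lift_inj _ ord0).
  apply/(@rshift_inj a)/(@perm_inj _ u)/val_inj.
  by have := hi k; have := hi k'; move: eq_k => /=; lia.
exists (perm f_inj), (perm g_inj); apply/permP => x; rewrite block_permE.
case: (blockP x) => [j||k]; apply: val_inj.
- by rewrite block_fun_lo permE.
- by rewrite block_fun_mid fix_mid.
- by rewrite block_fun_hi permE /= /bump; have := hi k; lia.
Qed.

(** Defined on all permutations, as reindexing a sum requires; the value is
    meaningful only when [a] is a strong fixed point. *)
Definition unblock {a b} (u : 'S_(a + b.+1)) : 'S_a * 'S_b :=
  odflt (1%g, 1%g) [pick st | block_perm st.1 st.2 == u].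

Lemma block_permK {a b} (s : 'S_a) (t : 'S_b) : unblock (block_perm s t) = (s, t).
Proof.
rewrite /unblock; case: pickP => [[s' t'] /eqP /block_perm_inj[/= -> ->] //|].
by move/(_ (s, t)); rewrite eqxx.
Qed.

Lemma unblockK {a b} (u : 'S_(a + b.+1)) :
  rshift a ord0 \in sfix u -> block_perm (unblock u).1 (unblock u).2 = u.
Proof. by move=> /sfix_block_perm[s [t ->]]; rewrite block_permK. Qed.

Definition block_tuple {m a b} (st : m.-tuple 'S_a * m.-tuple 'S_b) :
    m.-tuple 'S_(a + b.+1) :=
  [tuple block_perm (tnth st.1 k) (tnth st.2 k) | k < m].

Definition unblock_tuple {m a b} (u : m.-tuple 'S_(a + b.+1)) :
    m.-tuple 'S_a * m.-tuple 'S_b :=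
  ([tuple (unblock (tnth u k)).1 | k < m],
   [tuple (unblock (tnth u k)).2 | k < m]).

Lemma block_tupleK {m a b} : cancel (@block_tuple m a b) unblock_tuple.
Proof.
case=> s t; congr pair; apply: eq_from_tnth => k;
  by rewrite !tnth_mktuple block_permK.
Qed.

Lemma unblock_tupleK {m a b} (u : m.-tuple 'S_(a + b.+1)) :
  rshift a ord0 \in csfix u -> block_tuple (unblock_tuple u) = u.
Proof.
move=> /csfixP u_mid; apply: eq_from_tnth => k.
by rewrite !tnth_mktuple unblockK.
Qed.

Lemma block_tuple_csfix_mid {m a b} (st : m.-tuple 'S_a * m.-tuple 'S_b) :
  rshift a ord0 \in csfix (block_tuple st).
Proof. by apply/csfixP => k; rewrite tnth_mktuple block_perm_sfix_mid. Qed.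

Lemma block_tuple_csfix_above {m a b} (st : m.-tuple 'S_a * m.-tuple 'S_b) :
  #|[set j in csfix (block_tuple st) | (a < j)%N]| = #|csfix st.2|.
Proof.
pose h (k : 'I_b) : 'I_(a + b.+1) := rshift a (lift ord0 k).
have h_inj : injective h by move=> k k' /rshift_inj/lift_inj.
rewrite -(card_imset _ h_inj); apply: eq_card => x.
have hE k : (h k \in csfix (block_tuple st)) = (k \in csfix st.2).
  rewrite !inE; apply: eq_forallb => i.
  by rewrite tnth_mktuple block_perm_sfix_hi.
rewrite inE; case: (blockP x) => [j||k].
- rewrite /= ltnNge ltnW // andbF; apply/esym/imsetP => -[k _] /eqP.
  by rewrite eq_lrshift.
- rewrite /= addn0 ltnn andbF; apply/esym/imsetP => -[k _] /rshift_inj.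
  by move/eqP; rewrite (negbTE (neq_lift _ _)).
- rewrite (mem_imset _ _ h_inj) hE /= /bump.
  by rewrite andb_idr // => _; lia.
Qed.

(** * The recursion *)

Definition csfix_gf {R : comNzRingType} (q : R) m n : R :=
  \sum_(t : m.-tuple 'S_n) q ^+ #|csfix t|.

(** The sum over [i] in [A] is [1 + q + ... + q ^ (|A| - 1)], since the number of
    elements of [A] above [i] takes each value below [|A|] once. The induction
    removes the minimum of [A], which leaves the counts at the other elements
    unchanged. *)
Lemma expr_card_above {R : comNzRingType} (q : R) n (A : {set 'I_n}) :
  q ^+ #|A| = 1 + (q - 1) * \sum_(i in A) q ^+ #|[set j in A | (i < j)%N]|.
Proof.
move: {2}#|A| (erefl #|A|) => c; elim: c A => [|c IHc] A cardA.
  move/eqP: (cardA); rewrite cards_eq0 => /eqP A0.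
  by rewrite cardA A0 big_set0 mulr0 addr0.
have /set0Pn[i0 Ai0] : A != set0 by rewrite -cards_eq0 cardA.
case: (arg_minnP (fun i : 'I_n => i : nat) Ai0) => x Ax x_min {i0 Ai0}.
have {}Ax : x \in A by [].
have cardAx : #|A :\ x| = c by move: cardA; rewrite (cardsD1 x) Ax => -[].
rewrite (big_setD1 x) //=.
have -> : [set j in A | (x < j)%N] = A :\ x.
  apply/setP => j; rewrite !inE andbC; case Aj: (j \in A);
    rewrite ?andbF ?andbT //.
  by have := x_min j Aj; rewrite -val_eqE /=; lia.
rewrite (eq_bigr (fun i : 'I_n => q ^+ #|[set j in A :\ x | (i < j)%N]|)).
  rewrite mulrDr addrCA -IHc // cardA cardAx exprS mulrBl mul1r.
  by rewrite subrK.
move=> i; rewrite !inE => /andP[_ Ai]; congr (_ ^+ _); apply: eq_card => j.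
rewrite !inE; case: eqVneq => //= -> ; rewrite Ax ltnNge.
by have -> := x_min i Ai.
Qed.

(** The weight only sees the block of length [b], hence the factor counting the
    tuples of the other block. The length is given by an equation because the
    positions of a tuple of length [n] cannot be split without one. *)
Lemma csfix_gf_split {R : comNzRingType} (q : R) m a b n (i : 'I_n) :
  n = (a + b.+1)%N -> i = a :> nat ->
  \sum_(t : m.-tuple 'S_n | i \in csfix t)
     q ^+ #|[set j in csfix t | (i < j)%N]| = (a`! ^ m)%:R * csfix_gf q m b.
Proof.
move=> def_n; move: i; rewrite {}def_n => i ia.
have -> : i = rshift a ord0 by apply: val_inj; rewrite /= ia addn0.
rewrite (reindex_onto block_tuple unblock_tuple); last exact: unblock_tupleK.
under eq_bigl do rewrite block_tuple_csfix_mid block_tupleK eqxx.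
under eq_bigr => st _ do rewrite /= addn0 block_tuple_csfix_above.
rewrite -(pair_big xpredT xpredT (fun _ t => q ^+ #|csfix t|)) /=.
by rewrite sumr_const card_tuple card_Sn mulr_natl.
Qed.

Lemma csfix_gf_rec {R : comNzRingType} (q : R) m n :
  csfix_gf q m n =
  (n`! ^ m)%:R + (q - 1) * \sum_(i < n) (i`! ^ m)%:R * csfix_gf q m (n - i.+1).
Proof.
rewrite /csfix_gf; under eq_bigr do rewrite expr_card_above.
rewrite big_split /= sumr_const card_tuple card_Sn; congr (_ + _).
rewrite -mulr_sumr; congr (_ * _).
rewrite (exchange_big_dep xpredT) //=; apply: eq_bigr => i _.
by apply: csfix_gf_split => //; have := ltn_ord i; lia.
Qed.

(** * The generating function *)

Lemma fcoefXM {R : comUnitRingType} (f : fps R) n :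
  fcoef (fpsX * f) n = if n is k.+1 then fcoef f k else 0.
Proof.
rewrite fcoefM; case: n => [|n]; first by rewrite big_ord1 mul0r.
rewrite 2!big_ord_recl /= mul0r add0r mul1r subSS subn0 big1 ?addr0 // => i _.
by rewrite mul0r.
Qed.

Lemma csfix_series {R : comUnitRingType} (q : R) d :
  Fps (csfix_gf q d.-1) =
  Fd_series R d / (1 + fpsX * fpsC (1 - q) * Fd_series R d).
Proof.
set F := Fd_series R d; set f := Fps _; set g := 1 + _.
have g_unit : g \is a GRing.unit.
  (* A series is a unit when its constant coefficient is one. *)
  change (fcoef g 0 \is a GRing.unit).
  by rewrite /g -mulrA fcoefD fcoef1 fcoefXM addr0 unitr1.
apply: (canRL (mulrK g_unit)).
rewrite mulrDr mulr1 mulrC -!mulrA.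
apply: fpsP => n; rewrite fcoefD fcoefXM.
rewrite [fcoef f n]csfix_gf_rec; case: n => [|n].
  by rewrite big_ord0 mulr0 !addr0.
rewrite fcoefCM fcoefM -(opprB 1 q) mulNr.
under [X in _ * X]eq_bigr do rewrite subSS.
by rewrite addrNK.
Qed.

(** * From occurrences to strong fixed points *)

(** Complements the values of the components whose sign in [C] disagrees with
    that of the first component. The latter is the identity permutation, so it
    cannot be complemented, and it serves as the reference. *)
Definition align {d n} (C : signs d.+1) (Pi : dperm d.+1 n) : d.-tuple 'S_n :=
  [tuple if tnth C (lift ord0 k) == tnth C ord0 then tnth Pi k
         else (tnth Pi k * perm (@rev_ord_inj n))%g | k < d].

Lemma rev_perm_lt {n} (s : 'S_n) (i j : 'I_n) : j != i ->
  ((s * perm (@rev_ord_inj n))%g i < (s * perm (@rev_ord_inj n))%g j)%N =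
  ~~ (s i < s j)%N.
Proof.
rewrite -(inj_eq (@perm_inj _ s)) -val_eqE !permM !permE /=.
by have := ltn_ord (s i); have := ltn_ord (s j); lia.
Qed.

Lemma align_inj {d n} (C : signs d.+1) : injective (@align d n C).
Proof.
move=> Pi Pi' eq_al; apply: eq_from_tnth => k.
move: eq_al => /(congr1 (fun t => tnth t k)); rewrite !tnth_mktuple.
by case: ifP => // _ /mulIg.
Qed.

Lemma csignsK d : involutive (@csigns d).
Proof. by move=> C; apply: eq_from_tnth => k; rewrite !tnth_mktuple negbK. Qed.

Lemma csigns_neq {d} (C : signs d.+1) : csigns C != C.
Proof.
apply/eqP => /(congr1 (fun t => tnth t ord0)); rewrite tnth_mktuple.
by case: (tnth C ord0).
Qed.

(** Two sign vectors are missing from [P], and their set is closed under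
    [csigns], which has no fixed point. *)
Lemma antipodal_compl {d} {P : smp d.+1} :
  plus_antipodal P -> #|P| = (2 ^ d.+1 - 2)%N ->
  exists C, ~: P = [set C; csigns C].
Proof.
move=> hP hcard.
have: #|~: P| = 2.
  have := cardsC P; rewrite card_tuple card_bool hcard.
  have : (2 <= 2 ^ d.+1)%N by rewrite expnS leq_pmulr ?expn_gt0.
  lia.
case/eqP/cards2P=> C [D [neqCD defP]]; exists C.
have: csigns C \in ~: P.
  rewrite inE; apply: contraNN (_ : C \notin P).
    by move/hP; rewrite csignsK.
  by have := set21 C D; rewrite -defP inE.
by rewrite defP !inE (negbTE (csigns_neq C)) /= => /eqP <-.
Qed.

(** A sign vector is [C] or [csigns C] exactly when its agreement with [C] is the
    same in every component. For [sgn Pi i j] the first component is [i < j], and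
    correcting the others by their disagreement in [C] is what [align] does. *)
Lemma occ_csfix {d n} {P : smp d.+1} {C} (Pi : dperm d.+1 n) :
  ~: P = [set C; csigns C] -> occ P Pi = csfix (align C Pi).
Proof.
move=> defP; apply/setP => i.
have sgn0 j : tnth (sgn Pi i j) ord0 = (i < j)%N.
  by rewrite !tnth_mktuple /= !perm1.
have sgnS j k : tnth (sgn Pi i j) (lift ord0 k) = (tnth Pi k i < tnth Pi k j)%N.
  by rewrite !tnth_mktuple /= -!(tnth_nth 1%g).
have alignE j k : j != i ->
    (tnth (align C Pi) k i < tnth (align C Pi) k j)%N =
    tnth (sgn Pi i j) (lift ord0 k)
      (+) (tnth C (lift ord0 k) != tnth C ord0).
  move=> neq_ji; rewrite sgnS tnth_mktuple; case: ifP => _; first by rewrite addbF.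
  by rewrite addbT rev_perm_lt.
have in_compl D : (D \notin P) =
    [forall k, tnth D (lift ord0 k) (+) (tnth C (lift ord0 k) != tnth C ord0)
                 == tnth D ord0].
  rewrite -in_setC defP !inE; apply/orP/forallP => [D_pm k|D_C].
    by case: D_pm => /eqP ->; rewrite ?tnth_mktuple; do 2!case: (tnth C _).
  have {}D_C k : tnth D k = tnth D ord0 (+) (tnth C k != tnth C ord0).
    case: (unliftP ord0 k) => [k'|] ->; last by rewrite eqxx addbF.
    by rewrite -(eqP (D_C k')) addbK.
  have [eq0|neq0] := eqVneq (tnth D ord0) (tnth C ord0); [left|right];
    apply/eqP/eq_from_tnth => k; rewrite ?tnth_mktuple D_C.
    by rewrite eq0; do 2!case: (tnth C _).
  by move: neq0; case: (tnth D _); do 2!case: (tnth C _).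
rewrite inE; apply/forallP/csfixP => [occ_i k|fix_i j].
  apply/sfixP => j; have [->|neq_ji] := eqVneq j i; first by rewrite !ltnn.
  have := occ_i j; rewrite neq_ji in_compl => /forallP/(_ k)/eqP.
  by rewrite -alignE // sgn0.
apply/implyP => neq_ji; rewrite in_compl; apply/forallP => k.
by have /sfixP := fix_i k; rewrite -alignE // sgn0 => ->.
Qed.

Lemma occ_gf {d} {P : smp d.+1} {R : comNzRingType} (q : R) n :
  plus_antipodal P -> #|P| = (2 ^ d.+1 - 2)%N ->
  \sum_(Pi : dperm d.+1 n) q ^+ #|occ P Pi| = csfix_gf q d n.
Proof.
move=> hP hcard; have [C defP] := antipodal_compl hP hcard.
rewrite /csfix_gf [RHS](reindex_inj (align_inj C)).
by apply: eq_bigr => Pi _; rewrite (occ_csfix Pi defP).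
Qed.

Theorem theorem11 (d : nat) (P : smp d) (hd : (2 <= d)%N)
    (hP : plus_antipodal P) (hcard : #|P| = (2 ^ d - 2)%N) :
  A_series P = Fd_series int d / (1 + fpsX * Fd_series int d) /\
  FP_series P =
    Fd_series {poly int} d /
      (1 + fpsX * fpsC (1 - 'X : {poly int}) * Fd_series {poly int} d).
Proof.
case: d hd P hP hcard => // d _ P hP hcard; split; last first.
  by rewrite -csfix_series; apply: fpsP => n; rewrite /= (occ_gf 'X).
(* For q = 0 the factor 1 - q is 1; it is inserted to fit the formula. *)
have -> : fpsX = fpsX * fpsC (1 - 0) :> fps int by rewrite subr0 mulr1.
rewrite -csfix_series; apply: fpsP => n; rewrite /= -(occ_gf 0 n hP hcard).
rewrite /num_avoiders -sum1_card natr_sum big_mkcond /=.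
by apply: eq_bigr => Pi _; rewrite inE /avoids expr0n cards_eq0; case: ifP.
Qed.
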